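(* Let $H_1$ and $H_2$ be Hermitian spaces. Any adjointable map $f \colon \mathbf P(H_1) \to \mathbf P(H_2)$ between orthosets is a projective homomorphism. Moreover, the rank of $f$ as a map between orthosets coincides with the rank of $f$ as a projective homomorphism.
   Context: A sfield is a skew field (division ring). A $\ast$-sfield is a sfield $F$ with an involutory antiautomorphism $\ast \colon F \to F$. A Hermitian space over a $\ast$-sfield $F$ is a (left) linear space $H$ over $F$ with a map $(\cdot,\cdot)\colon H\times H\to F$ such that $(\alpha u+\beta v,w)=\alpha(u,w)+\beta(v,w)$, $(w,\alpha u+\beta v)=(w,u)\alpha^\ast+(w,v)\beta^\ast$, $(u,v)=(v,u)^\ast$ for all $u,v,w\in H$, $\alpha,\beta\in F$, and which is anisotropic: $(u,u)=0$ implies $u=0$. We write $u\perp v$ if $(u,v)=0$. The scalar $\ast$-sfields of $H_1$ and $H_2$ may be different. Standing assumption: a Hermitian space contains at most countably many mutually orthogonal nonzero vectors. For a Hermitian space $H$, $\mathbf P(H)=\{\langle u\rangle: u\in H\}$ is the set of at most one-dimensional subspaces of $H$ ($\langle \cdot\rangle$ denotes linear span). It carries two structures. (1) Projective space with $0$: $\langle u\rangle\star\langle v\rangle=\{\langle w\rangle:w\in\langle u,v\rangle\}$, with constant $\{0\}$. A subspace of the projective space $\mathbf P(H)$ is a subset containing $\{0\}$ and containing $a\star b$ for any two of its members $a,b$; the subspace spanned by a subset is the smallest subspace containing it. The rank of a subspace is the smallest $n$ such that it is spanned by an $n$-element set, or $\infty$ if it is not spanned by a finite set (for the subspace $\{\langle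 u\rangle:u\in S\}$, where $S$ is a linear subspace of $H$, this is $\dim S$). A projective homomorphism $f\colon\mathbf P(H_1)\to\mathbf P(H_2)$ is a map such that $a\in b\star c$ implies $f(a)\in f(b)\star f(c)$ and $f(\{0\})=\{0\}$; its rank (as a projective homomorphism) is the rank of the subspace of the projective space $\mathbf P(H_2)$ spanned by $\operatorname{im} f$. (2) Orthoset: $\langle u\rangle\perp\langle v\rangle$ if $u\perp v$, with constant $0=\{0\}$. Here an orthoset is a set $X$ with a symmetric binary relation $\perp$ and a constant $0$ such that $x\perp x$ if and only if $x=0$, and $0\perp x$ for all $x\in X$. Elements distinct from $0$ are proper. For $A\subseteq X$, $A^\perp=\{x\in X: x\perp y\text{ for all }y\in A\}$; a subspace of an orthoset is a subset $A$ with $A=A^{\perp\perp}$, viewed as an orthoset with the inherited relation. The rank of an orthoset is the maximal size $n$ of a set of mutually orthogonal proper elements if such a finite maximum exists, and $\infty$ otherwise. A map $f\colon X\to Y$ between orthosets is adjointable if there is a map $g\colon Y\to X$ such that for all $x\in X$, $y\in Y$: $f(x)\perp y$ if and only if $x\perp g(y)$; its rank (as a map between orthosets) is the rank of the subspace $(\operatorname{im} f)^{\perp\perp}$ of $Y$. *)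

(* Defs.v *)
From HB Require Import structures.
From mathcomp Require Import all_boot all_order all_algebra.
From mathcomp Require Import boolp classical_sets functions cardinality.

Set Implicit Arguments.
Unset Strict Implicit.
Unset Printing Implicit Defensive.

Import GRing.Theory.

Local Open Scope classical_set_scope.
Local Open Scope card_scope.
Local Open Scope ring_scope.

(* MathComp has no division rings: a sfield is a unit ring (not assumed
   commutative, with 1 != 0) in which every nonzero element is a unit. *)
HB.mixin Record UnitRing_isStarSfield F of GRing.UnitRing F := {
  sfield_unit : forall x : F, x != 0 -> x \is a GRing.unit;
  star : F -> F;
  starD : forall x y, star (x + y) = star x + star y;
  starM : forall x y, star (x * y) = star y * star x;
  starK : forall x, star (star x) = x
}.

#[short(type="starSfieldType")]
HB.structure Definition StarSfield :=
  { F of UnitRing_isStarSfield F & GRing.UnitRing F }.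

HB.mixin Record Lmodule_isHermitian (F : starSfieldType) H
    of GRing.Lmodule F H := {
  hform : H -> H -> F;
  hformDZl : forall (a b : F) (u v w : H),
    hform (a *: u + b *: v) w = a * hform u w + b * hform v w;
  hformDZr : forall (a b : F) (u v w : H),
    hform w (a *: u + b *: v) = hform w u * star a + hform w v * star b;
  hform_star : forall u v : H, hform u v = star (hform v u);
  hform_anisotropic : forall u : H, hform u u = 0 -> u = 0;
  (* standing assumption: orthogonal families are at most countable *)
  hform_countable : forall A : set H,
    (forall u, A u -> u <> 0) ->
    (forall u v, A u -> A v -> u <> v -> hform u v = 0) ->
    countable A
}.

#[short(type="hermitianType")]
HB.structure Definition Hermitian (F : starSfieldType) :=
  { H of Lmodule_isHermitian F H & GRing.Lmodule F H }.

HB.mixin Record isOrthoset X := {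
  orth : X -> X -> Prop;
  ozero : X;
  orth_sym : forall x y, orth x y -> orth y x;
  orthxx : forall x, orth x x <-> x = ozero;
  orth0x : forall x, orth ozero x
}.

#[short(type="orthosetType")]
HB.structure Definition Orthoset := { X of isOrthoset X }.

Arguments ozero {s}.

(* In all ranks below, None stands for infinity. *)

Section OrthosetTheory.
Variable X : orthosetType.

Definition ocompl (A : set X) : set X :=
  [set x | forall y, A y -> orth x y].

Definition mutually_orthogonal (B : set X) : Prop :=
  (forall x, B x -> x <> ozero) /\
  (forall x y, B x -> B y -> x <> y -> orth x y).

(* The rank of the orthoset that A carries when equipped with the inherited
   relation. *)
Definition orthoset_rank (A : set X) : option nat :=
  xget None [set Some n | n in [set n : nat |
    (exists B : set X, [/\ B `<=` A, mutually_orthogonal B & B #= `I_n]) /\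
    (forall B : set X, B `<=` A -> mutually_orthogonal B -> B #<= `I_n)]].

End OrthosetTheory.

Definition adjointable (X Y : orthosetType) (f : X -> Y) : Prop :=
  exists g : Y -> X, forall x y, orth (f x) y <-> orth x (g y).

Definition orthoset_map_rank (X Y : orthosetType) (f : X -> Y) : option nat :=
  orthoset_rank (ocompl (ocompl (range f))).

Section ProjectiveSpace.
Variables (F : starSfieldType) (H : hermitianType F).

Definition span1 (u : H) : set H := [set a *: u | a in [set: F]].

Definition span2 (u v : H) : set H :=
  [set w | exists a b : F, w = a *: u + b *: v].

Definition Proj : Type := {L : set H | exists u, L = span1 u}.

Definition line (u : H) : Proj := exist _ (span1 u) (ex_intro _ u erefl).

Definition pjoin (x y : Proj) : set Proj :=
  [set z | exists u v : H,
     [/\ x = line u, y = line v & exists2 w, span2 u v w & z = line w]].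

Definition proj_subspace (S : set Proj) : Prop :=
  S (line 0) /\ forall a b, S a -> S b -> pjoin a b `<=` S.

Definition proj_span (A : set Proj) : set Proj := smallest proj_subspace A.

Definition proj_rank (S : set Proj) : option nat :=
  xget None [set Some n | n in [set n : nat |
    (exists B : set Proj, B #= `I_n /\ proj_span B = S) /\
    (forall (m : nat) (B : set Proj),
       B #= `I_m -> proj_span B = S -> (n <= m)%N)]].

Definition proj_orth (x y : Proj) : Prop :=
  exists u v : H, [/\ x = line u, y = line v & hform u v = 0].

Lemma lineP (x : Proj) : exists u, x = line u.
Proof. by case: x => L [u eL]; exists u; apply: eq_exist. Qed.

Lemma line_eqP (u v : H) : line u = line v <-> span1 u = span1 v.
Proof. by split=> [/(congr1 sval) | ?]; last exact: eq_exist. Qed.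

Lemma span1_id (u : H) : span1 u u.
Proof. by exists 1 => //; rewrite scale1r. Qed.

Lemma line_mem (u v : H) : line u = line v -> exists a : F, u = a *: v.
Proof.
by move=> /line_eqP e; have := span1_id u; rewrite e => -[a _ <-]; exists a.
Qed.

Lemma hformZl (a : F) (u w : H) : hform (a *: u) w = a * hform u w.
Proof. by have := hformDZl a 0 u u w; rewrite scale0r mul0r !addr0. Qed.

Lemma star0 : star (0 : F) = 0.
Proof. by apply: (addrI (star (0 : F))); rewrite -starD !addr0. Qed.

Lemma hformZr (a : F) (u w : H) : hform w (a *: u) = hform w u * star a.
Proof.
by have := hformDZr a 0 u u w; rewrite star0 scale0r mulr0 !addr0.
Qed.

Lemma hform0l (w : H) : hform 0 w = 0.
Proof. by rewrite -(scale0r w) hformZl mul0r. Qed.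

Lemma proj_orthE (u v : H) : proj_orth (line u) (line v) <-> hform u v = 0.
Proof.
split=> [[u' [v' [/line_mem[a ->] /line_mem[b ->] e]]]|e]; last by exists u, v.
by rewrite hformZl hformZr e mul0r mulr0.
Qed.

Lemma pjoinE (u v : H) :
  pjoin (line u) (line v) = [set line w | w in span2 u v].
Proof.
apply/seteqP; split=> [z [u' [v' [eu ev [w [a [b ->]] ->]]]]|z [w uvw <-]].
  have [c ->] := line_mem (esym eu); have [d ->] := line_mem (esym ev).
  by exists (a *: (c *: u) + b *: (d *: v)) => //=; rewrite !scalerA; exists (a * c), (b * d).
by exists u, v; split=> //; exists w.
Qed.

Lemma proj_orth_sym (x y : Proj) : proj_orth x y -> proj_orth y x.
Proof.
by case=> u [v [-> -> e]]; exists v, u; split=> //; rewrite hform_star e star0.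
Qed.

Lemma proj_orthxx (x : Proj) : proj_orth x x <-> x = line 0.
Proof.
have [u ->] := lineP x; rewrite proj_orthE; split.
  by move/hform_anisotropic->.
by case/line_mem=> a ->; rewrite scaler0 hform0l.
Qed.

Lemma proj_orth0x (x : Proj) : proj_orth (line 0) x.
Proof. by have [u ->] := lineP x; apply/proj_orthE/hform0l. Qed.

HB.instance Definition _ :=
  isOrthoset.Build Proj proj_orth_sym proj_orthxx proj_orth0x.

End ProjectiveSpace.

Definition proj_hom (F1 F2 : starSfieldType) (H1 : hermitianType F1)
    (H2 : hermitianType F2) (f : Proj H1 -> Proj H2) : Prop :=
  (forall a b c, pjoin b c a -> pjoin (f b) (f c) (f a)) /\
  f (line 0) = line 0.

Definition proj_hom_rank (F1 F2 : starSfieldType) (H1 : hermitianType F1)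
    (H2 : hermitianType F2) (f : Proj H1 -> Proj H2) : option nat :=
  proj_rank (proj_span (range f)).

(* Main.v *)
Require Import Defs.
From HB Require Import structures.
From mathcomp Require Import all_boot all_order all_algebra.
From mathcomp Require Import boolp classical_sets functions cardinality.

(* If a is in b * c, then f a is orthogonal to everything orthogonal to f b and
   f c, because f preserves double orthogonal complements; and finitely spanned
   subspaces of a Hermitian space are closed under double complement, because
   orthogonal projection onto them exists.  For the ranks, let S be the
   projective span of the image A.  Both ranks are finite exactly when S has a
   finite orthogonal basis: a maximal orthogonal family inside S is one, and so
   is the Gram-Schmidt orthogonalization of a finite spanning family.  In that
   case S is the double complement of A, and the exchange argument identifies
   both ranks with the size of the basis. *)

Set Implicit Arguments.
Unset Strict Implicit.
Unset Printing Implicit Defensive.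

Import GRing.Theory.

Local Open Scope classical_set_scope.
Local Open Scope ring_scope.

(** * Finite linear spans, orthogonal projection and orthogonal families *)

Section HermitianSpace.
Variables (F : starSfieldType) (H : hermitianType F).
Implicit Types (u v w x d : H) (s t C D : seq H).

Lemma hformDl u v w : hform (u + v) w = hform u w + hform v w.
Proof. by have := hformDZl 1 1 u v w; rewrite !scale1r !mul1r. Qed.

Lemma hformBl u v w : hform (u - v) w = hform u w - hform v w.
Proof. by rewrite -scaleN1r hformDl hformZl mulN1r. Qed.

Lemma hformDr u v w : hform w (u + v) = hform w u + hform w v.
Proof. by rewrite hform_star hformDl starD -!hform_star. Qed.

Lemma hform_eq0C u v : hform u v = 0 -> hform v u = 0.
Proof. by move=> e; rewrite hform_star e star0. Qed.

Lemma hform_unit u : u != 0 -> hform u u \is a GRing.unit.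
Proof.
by move=> u0; apply/sfield_unit; apply: contra_neq u0 => /hform_anisotropic.
Qed.

(** The part of [v] orthogonal to [d]. Dividing on the right by [hform d d] is what cancels in
    [hform _ d] over a noncommutative sfield. *)
Definition reject d v : H := v - (hform v d / hform d d) *: d.

Lemma reject_orth d v : d != 0 -> hform (reject d v) d = 0.
Proof. by move=> /hform_unit dU; rewrite hformBl hformZl mulrVK ?subrr. Qed.

Lemma reject_self d : d != 0 -> reject d d = 0.
Proof. by move=> /hform_unit dU; rewrite /reject divrr ?scale1r ?subrr. Qed.

Lemma reject_id d v : hform v d = 0 -> reject d v = v.
Proof. by move=> e; rewrite /reject e mul0r scale0r subr0. Qed.

Lemma rejectDZ d a u v : reject d (a *: u + v) = a *: reject d u + reject d v.
Proof.
rewrite /reject hformDl hformZl mulrDl scalerDl opprD scalerBr scalerA mulrA.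
by rewrite addrACA.
Qed.

Fixpoint lspan s : set H :=
  if s is b :: s' then
    [set v | exists a, exists2 w, lspan s' w & v = a *: b + w]
  else [set 0].

Lemma lspan0 s : lspan s 0.
Proof. by elim: s => //= b s IH; exists 0, 0; rewrite ?scale0r ?addr0. Qed.

Lemma lspanDZ s a u v : lspan s u -> lspan s v -> lspan s (a *: u + v).
Proof.
elim: s u v => /= [u v -> ->|b s IH u v [c [u' su' ->]] [d [v' sv' ->]]].
  by rewrite scaler0 addr0.
exists (a * c + d), (a *: u' + v'); first exact: IH.
by rewrite scalerDr scalerA scalerDl addrACA.
Qed.

Lemma lspanZ s a u : lspan s u -> lspan s (a *: u).
Proof. by move=> su; rewrite -[_ *: _]addr0; apply/lspanDZ/lspan0. Qed.

Lemma lspanB s u v : lspan s u -> lspan s v -> lspan s (u - v).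
Proof. by move=> su sv; rewrite addrC -scaleN1r; apply: lspanDZ. Qed.

Lemma lspan_behead b s u : lspan s u -> lspan (b :: s) u.
Proof. by exists 0, u; rewrite // scale0r add0r. Qed.

Lemma lspan_mem s u : u \in s -> lspan s u.
Proof.
elim: s => // b s IH; rewrite inE => /predU1P[->|/IH]; last exact: lspan_behead.
by exists 1, 0; rewrite ?scale1r ?addr0 //; apply: lspan0.
Qed.

Lemma lspan_reject d s v : lspan s v -> lspan (map (reject d) s) (reject d v).
Proof.
elim: s v => [|b s IH] /= v; first by move=> ->; rewrite reject_id ?hform0l.
by case=> a [w sw ->]; exists a, (reject d w); rewrite ?rejectDZ //; apply: IH.
Qed.

(** Steinitz exchange: the first generator with a nonzero coefficient in [d] is expressed through
    [d] and the later ones, and is dropped. *)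
Lemma lspan_exchange s d : lspan s d -> d != 0 ->
  exists2 t, size s = (size t).+1 & lspan s `<=` lspan (d :: t).
Proof.
elim: s d => [_ -> /eqP //|b s IH _ [a [w sw ->]] d0].
have [a0|a0] := eqVneq a 0.
  move: d0; rewrite a0 scale0r add0r => w0.
  have [t st sub] := IH _ sw w0; exists (b :: t); first by rewrite /= st.
  move=> _ [c [x sx ->]]; have [e [y ty ->]] := sub _ sx.
  exists e, (c *: b + y); last by rewrite addrCA.
  by exists c, y.
exists s => // _ [c [x sx ->]]; have aU := sfield_unit _ a0.
(* From [d = a *: b + w] comes [b = a^-1 *: (d - w)], to be substituted in [c *: b + x]. *)
exists (c / a), (- (c / a) *: w + x); first exact: lspanDZ.
by rewrite scalerDr scalerA mulrVK // scaleNr addrA addrK.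
Qed.

Lemma lspan_decomp s v :
  exists2 w, lspan s w & forall x, lspan s x -> hform (v - w) x = 0.
Proof.
elim: s v => [|b s IH] v.
  by exists 0 => // _ ->; apply/hform_eq0C/hform0l.
have [wb sb ob] := IH b; have [wv sv ov] := IH v.
have bE : b = (b - wb) + wb by rewrite subrK.
(* The span of [b :: s] is the orthogonal sum of the span of [s] and the line of [b - wb]. If
   [b - wb = 0], the projection [wv] already serves. *)
have [b0|b0] := eqVneq (b - wb) 0.
  exists wv; first exact: lspan_behead.
  move=> _ [a [y sy ->]]; apply: ov; apply: lspanDZ => //.
  by rewrite bE b0 add0r.
(* This is [wv] plus the projection of [v - wv] onto the line of [b - wb]. *)
exists (v - reject (b - wb) (v - wv)).
  rewrite /reject opprB addrCA subKr; apply: lspanDZ.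
    by apply: lspanB; [apply: lspan_mem; rewrite mem_head|exact: lspan_behead].
  exact: lspan_behead.
rewrite subKr => _ [a [y sy ->]].
rewrite {2}bE scalerDr -addrA hformDr hformZr reject_orth // mul0r add0r.
have syb : lspan s (a *: wb + y) by exact: lspanDZ.
by rewrite [LHS]hformBl hformZl (ov _ syb) (ob _ syb) mulr0 subr0.
Qed.

(** With [w] the projection of [v], the vector [v - w] is orthogonal to [s], hence to [v] by
    hypothesis and to [w]. It is thus isotropic, so zero. *)
Lemma lspan_biorth s v :
  (forall x, {in s, forall u, hform x u = 0} -> hform v x = 0) -> lspan s v.
Proof.
move=> vs; have [w sw ow] := lspan_decomp s v.
suff /hform_anisotropic /eqP : hform (v - w) (v - w) = 0.
  by rewrite subr_eq0 => /eqP->.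
have ows : {in s, forall u, hform (v - w) u = 0}.
  by move=> u /lspan_mem/ow.
by rewrite hformBl vs // (hform_eq0C (ow _ sw)) subrr.
Qed.

(** Pairs are taken by position, so a repeated entry would be isotropic, hence zero: such a list is
    duplicate-free. *)
Definition orthoseq s : bool :=
  (0 \notin s) && pairwise (fun u v => hform u v == 0) s.

Lemma orthoseq_cons d s :
  orthoseq (d :: s) <->
  [/\ d != 0, {in s, forall u, hform d u = 0} & orthoseq s].
Proof.
rewrite /orthoseq inE eq_sym negb_or pairwise_cons; split.
  case/andP=> /andP[-> s0] /andP[/allP ds ps]; split=> //; last exact/andP.
  by move=> u /ds /eqP.
case=> -> ds /andP[-> ->]; rewrite /= andbT; apply/allP => u us.
by rewrite ds ?eqxx.
Qed.

(** Exchange the head [d] for a generator, then apply [reject d]: it kills [d] and fixes the rest of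
    [D], which therefore lies in the span of one generator fewer. *)
Lemma size_orthoseq D s :
  orthoseq D -> {in D, forall d, lspan s d} -> (size D <= size s)%N.
Proof.
elim: D s => // d D IH s /orthoseq_cons[d0 dD oD] Ds.
have [t -> st] := lspan_exchange (Ds d (mem_head d D)) d0.
rewrite /= ltnS -(size_map (reject d) t); apply: IH => // u uD.
have /st[a [w tw uE]] : lspan s u by apply: Ds; rewrite inE uD orbT.
rewrite -(reject_id (hform_eq0C (dD _ uD))) uE rejectDZ reject_self //.
by rewrite scaler0 add0r; apply: lspan_reject.
Qed.

Lemma gram_schmidt s :
  exists C, [/\ orthoseq C, (size C <= size s)%N & lspan C = lspan s].
Proof.
elim: s => [|b s [C [oC sC eC]]]; first by exists [::].
have [w Cw ow] := lspan_decomp C b.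
have bE : b = 1 *: (b - w) + w by rewrite scale1r subrK.
have sw : lspan s w by rewrite -eC.
(* A generator that depends on the earlier ones adds nothing to [C], so [C] may be shorter than
   [s]. *)
have [b0|b0] := eqVneq (b - w) 0.
  exists C; split=> //; first exact: leqW.
  rewrite eC; apply/seteqP; split=> [|_ [a [x sx ->]]]; first exact: lspan_behead.
  by apply: lspanDZ; rewrite // bE b0 scaler0 add0r.
exists (b - w :: C); split=> //.
  by apply/orthoseq_cons; split=> // u /lspan_mem/ow.
apply/seteqP; split=> _ [a [x sx ->]].
  apply: lspanDZ; last by apply: lspan_behead; rewrite -eC.
  by apply: lspanB; [apply: lspan_mem; rewrite mem_head|exact: lspan_behead].
apply: lspanDZ; last by apply: lspan_behead; rewrite eC.
by exists 1, w.
Qed.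

Lemma orthoseq_nth_neq0 C i : orthoseq C -> (i < size C)%N -> nth 0 C i != 0.
Proof. by case/andP=> C0 _ iC; apply: contraNneq C0 => <-; apply: mem_nth. Qed.

Lemma orthoseq_nth_orth C i j : orthoseq C ->
  (i < size C)%N -> (j < size C)%N -> i != j -> hform (nth 0 C i) (nth 0 C j) = 0.
Proof.
case/andP=> _ /(pairwiseP 0) oC iC jC.
rewrite neq_ltn => /orP[ij|ji]; first exact/eqP/oC.
exact/hform_eq0C/eqP/oC.
Qed.

(** * Finite spans as subspaces of the projective space and of the orthoset *)

Definition lines (V : set H) : set (Proj H) := [set line u | u in V].

Lemma lines_lspan_mem s u : lines (lspan s) (line u) <-> lspan s u.
Proof.
split=> [[w sw /esym/line_mem[a ->]]|su]; [exact: lspanZ | by exists u].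
Qed.

Lemma lines_set s : lines [set` s] = [set line (nth 0 s i) | i in `I_(size s)].
Proof.
apply/seteqP; split=> [_ [u /= us <-]|_ [i /= si <-]].
  by exists (index u s); rewrite /= ?index_mem ?nth_index.
by exists (nth 0 s i) => //=; apply: mem_nth.
Qed.

Lemma proj_subspaceDZ (T : set (Proj H)) a u v : proj_subspace T ->
  T (line u) -> T (line v) -> T (line (a *: u + v)).
Proof.
move=> [_ Tj] Tu Tv; apply: (Tj _ _ Tu Tv); rewrite pjoinE.
by exists (a *: u + v) => //; exists a, 1; rewrite scale1r.
Qed.

Lemma lspan_proj_subspace (T : set (Proj H)) s : proj_subspace T ->
  lines [set` s] `<=` T -> lines (lspan s) `<=` T.
Proof.
move=> sT; elim: s => [_ _ [_ -> <-]|b s IH bsT _ [_ [a [w sw ->]] <-]].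
  by case: sT.
apply: proj_subspaceDZ => //; first by apply: bsT; exists b; rewrite //= mem_head.
apply: IH; last by exists w.
by move=> _ [u us <-]; apply: bsT; exists u; rewrite //= inE us orbT.
Qed.

Lemma proj_subspace_lspan s : proj_subspace (lines (lspan s)).
Proof.
split=> [|_ _ [u su <-] [v sv <-]]; first by exists 0; first exact: lspan0.
rewrite pjoinE => _ [_ [a [b ->]] <-]; apply/lines_lspan_mem.
by apply: lspanDZ => //; apply: lspanZ.
Qed.

Lemma proj_subspace_span (A : set (Proj H)) : proj_subspace (proj_span A).
Proof.
split=> [T [[T0 _] _]|a b Aa Ab c abc T sT]; first exact: T0.
by have [[_ Tj] _] := sT; apply: Tj abc; [apply: Aa|apply: Ab].
Qed.

Lemma proj_span_lines s : proj_span (lines [set` s]) = lines (lspan s).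
Proof.
apply/seteqP; split.
  apply: smallest_sub; first exact: proj_subspace_lspan.
  by move=> _ [u /lspan_mem su <-]; exists u.
exact: (lspan_proj_subspace (proj_subspace_span _) (@sub_gen_smallest _ _ _)).
Qed.

Lemma proj_subspace_ocompl (A : set (Proj H)) : proj_subspace (ocompl A).
Proof.
split=> [x _|a b Aa Ab c]; first exact: orth0x.
have [u ea] := lineP a; have [v eb] := lineP b; rewrite ea eb in Aa Ab *.
rewrite pjoinE => -[_ [e [d ->]] <-] x Ax; have [y ey] := lineP x.
move: (Aa x Ax) (Ab x Ax); rewrite ey => /proj_orthE ux /proj_orthE vx.
by apply/proj_orthE; rewrite hformDZl ux vx !mulr0 addr0.
Qed.

Lemma sub_ocomplK (X : orthosetType) (A : set X) : A `<=` ocompl (ocompl A).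
Proof. by move=> x Ax y Ay; apply/orth_sym/Ay. Qed.

Lemma sub_ocompl (X : orthosetType) (A B : set X) :
  A `<=` B -> ocompl B `<=` ocompl A.
Proof. by move=> AB x Bx y /AB; apply: Bx. Qed.

Lemma lspan_ocomplK s : ocompl (ocompl (lines [set` s])) `<=` lines (lspan s).
Proof.
move=> x; have [v ->] := lineP x => Cv; apply/lines_lspan_mem/lspan_biorth => y sy.
by apply/proj_orthE/Cv => _ [u us <-]; apply/proj_orthE/sy.
Qed.

Lemma proj_span_sub_ocomplK (A : set (Proj H)) :
  proj_span A `<=` ocompl (ocompl A).
Proof.
by apply: smallest_sub; [exact: proj_subspace_ocompl|exact: sub_ocomplK].
Qed.

Lemma ocompl_proj_span (A : set (Proj H)) : ocompl (proj_span A) = ocompl A.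
Proof.
apply/seteqP; split; first by apply: sub_ocompl; exact: sub_gen_smallest.
move=> x Ax y /proj_span_sub_ocomplK Ay; exact/orth_sym/Ay.
Qed.

Lemma lines_orthoseq C : orthoseq C ->
  mutually_orthogonal (lines [set` C]) /\ (lines [set` C] #= `I_(size C))%card.
Proof.
move=> oC; rewrite lines_set; split; first split.
- move=> _ [i iC <-] /line_mem[a]; rewrite scaler0.
  exact/eqP/orthoseq_nth_neq0.
- move=> _ _ [i iC <-] [j jC <-] nij; apply/proj_orthE/orthoseq_nth_orth => //.
  by apply: contra_not_neq nij => ->.
apply: inj_card_eq => i j; rewrite !inE /= => iC jC eij.
(* Two positions with the same line would hold proportional orthogonal vectors, forcing the entry at
   [i] to be zero. *)
apply: contraNeq (orthoseq_nth_neq0 oC iC) => nij; apply/eqP.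
have [a ei] := line_mem eij; apply: hform_anisotropic.
by rewrite {2}ei hformZr orthoseq_nth_orth // mul0r.
Qed.

Lemma lines_card_seq (B : set (Proj H)) n : (B #= `I_n)%card ->
  exists s, [/\ size s = n, lines [set` s] = B &
    mutually_orthogonal B -> orthoseq s].
Proof.
move=> /card_set_bijP[h [hB hI hS]].
have /choice[r rP] : forall i, exists u : H,
    (i < n)%N -> B (line u) /\ h (line u) = i.
  (* The value 0 for [i >= n] is a dummy: only the first [n] representatives enter the list. *)
  move=> i; have [/hS[x Bx hx]|ni] := ltnP i n; last by exists 0.
  by have [u xE] := lineP x; exists u; rewrite -xE.
exists (mkseq r n); rewrite size_mkseq; split=> //.
  rewrite lines_set size_mkseq; apply/seteqP; split=> [_ [i ni <-]|x Bx].
    by rewrite nth_mkseq //; case: (rP i ni).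
  have hx : (h x < n)%N by exact: hB.
  have [Br hr] := rP _ hx; exists (h x) => //; rewrite nth_mkseq //.
  by apply: hI; rewrite ?inE.
case=> B0 Bo; apply/andP; split.
  apply/negP => /mapP[i]; rewrite mem_iota => /= ni ei.
  by case: (rP i ni) => /B0 + _; rewrite -ei.
apply/(pairwiseP 0) => i j; rewrite !inE size_mkseq => ni nj ij.
rewrite !nth_mkseq //; have [Bi hi] := rP _ ni; have [Bj hj] := rP _ nj.
apply/eqP/proj_orthE/Bo => // eij; move: ij.
by rewrite -hi -hj eij ltnn.
Qed.

End HermitianSpace.

(** * Equality of the two ranks *)

Lemma card_le_II_sub T (B : set T) n :
  (forall m C, C `<=` B -> (C #= `I_m)%card -> (m <= n)%N) -> (B #<= `I_n)%card.
Proof.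
move=> Bn; have [/finite_setP[m Bm]|/infiniteP iB] := pselect (finite_set B).
  by rewrite (card_le_eql Bm) card_le_II (Bn _ _ _ Bm).
(* An infinite [B] would have a subset with [n + 1] elements. *)
have /card_subP[C Cn CB] : (`I_n.+1 #<= B)%card.
  by apply: card_le_trans iB; apply: subset_card_le.
by have := Bn _ _ CB Cn; rewrite ltnn.
Qed.

Section Rank.
Variables (F : starSfieldType) (H : hermitianType F) (A : set (Proj H)).

Let orthobasis C := orthoseq C /\ proj_span A = lines (lspan C).

Lemma maximal_orthoseq n :
  (forall C, orthoseq C -> lines [set` C] `<=` proj_span A -> (size C <= n)%N) ->
  exists C, orthobasis C.
Proof.
move=> Cn; pose P k := `[< exists C, [/\ orthoseq C,
  lines [set` C] `<=` proj_span A & size C = k] >].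
have P0 : exists k, P k.
  by exists 0%N; apply/asboolP; exists [::]; split=> // _ [u us <-].
have Pn k : P k -> (k <= n)%N by move=> /asboolP[C [oC /(Cn _ oC) + <-]].
have [_ /asboolP[C [oC CA <-]] Cmax] := ex_maxnP P0 Pn.
have sA := proj_subspace_span A; have CsA := lspan_proj_subspace sA CA.
exists C; split=> //; apply/seteqP; split=> // x; have [u ->] := lineP x => Au.
have [w Cw ow] := lspan_decomp C u; apply/lines_lspan_mem.
have [/eqP|uw0] := eqVneq (u - w) 0; first by rewrite subr_eq0 => /eqP->.
(* A nonzero [u - w] is orthogonal to [C] and its line stays in the span of [A], so it would extend
   the maximal family. *)
have /Cmax : P (size (u - w :: C)); last by rewrite ltnn.
apply/asboolP; exists (u - w :: C); split=> //.
  by apply/orthoseq_cons; split=> // v /lspan_mem/ow.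
move=> _ [v vC <-]; move: vC; rewrite /= in_cons => /predU1P[->|vC].
  rewrite addrC -scaleN1r; apply: (proj_subspaceDZ _ sA) => //.
  by apply: CsA; exists w.
by apply: CA; exists v.
Qed.

Lemma orthobasis_orthoset_rank C n : orthobasis C ->
  ((exists B : set (Proj H),
      [/\ B `<=` ocompl (ocompl A), mutually_orthogonal B & B #= `I_n]) /\
   (forall B : set (Proj H), B `<=` ocompl (ocompl A) ->
      mutually_orthogonal B -> B #<= `I_n))%card <-> n = size C.
Proof.
(* A set and its projective span have the same complement, so [A] may be replaced by the lines of
   [C], whose double complement is their finite span. *)
move=> [oC AC]; have AE : ocompl (ocompl A) = lines (lspan C).
  have -> : ocompl A = ocompl (lines [set` C]).
    by rewrite -(ocompl_proj_span A) AC -proj_span_lines ocompl_proj_span.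
  apply/seteqP; split; first exact: lspan_ocomplK.
  by rewrite -proj_span_lines; exact: proj_span_sub_ocomplK.
have CC : lines [set` C] `<=` lines (lspan C).
  by rewrite -proj_span_lines; exact: sub_gen_smallest.
have [moC cC] := lines_orthoseq oC.
have ub m (B : set (Proj H)) : B `<=` lines (lspan C) -> mutually_orthogonal B ->
    (B #= `I_m)%card -> (m <= size C)%N.
  move=> BC oB /lines_card_seq[s [<- sB /(_ oB) os]]; apply: size_orthoseq => // d ds.
  by apply/lines_lspan_mem/BC; rewrite -sB; exists d.
rewrite AE; split=> [[[B [BC oB Bn]] Bmax]|->].
  apply/eqP; rewrite eqn_leq (ub _ _ BC oB Bn) /=.
  by rewrite -card_le_II -(card_le_eql cC); apply: Bmax.
split=> [|B BC [B0 oB]]; first by exists (lines [set` C]).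
apply: card_le_II_sub => m D DB; apply: ub; first exact: subset_trans BC.
by split=> [x /DB/B0|x y /DB Bx /DB By]; last exact: oB.
Qed.

Lemma orthobasis_proj_rank C n : orthobasis C ->
  ((exists B : set (Proj H), B #= `I_n /\ proj_span B = proj_span A) /\
   (forall m (B : set (Proj H)), B #= `I_m -> proj_span B = proj_span A ->
      (n <= m)%N))%card <-> n = size C.
Proof.
move=> [oC AC]; have [_ cC] := lines_orthoseq oC.
have lb m (B : set (Proj H)) : (B #= `I_m)%card -> proj_span B = proj_span A ->
    (size C <= m)%N.
  move=> /lines_card_seq[s [<- <- _]]; rewrite proj_span_lines AC => sC.
  apply: size_orthoseq => // d /lspan_mem Cd; apply/lines_lspan_mem.
  by rewrite sC; exists d.
have CA : proj_span (lines [set` C]) = proj_span A by rewrite proj_span_lines.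
split=> [[[B [Bn BA]] Bmin]|->].
  by apply/eqP; rewrite eqn_leq (lb _ _ Bn BA) andbT (Bmin _ _ cC CA).
by split=> //; exists (lines [set` C]).
Qed.

(** The predicates selecting the two ranks are shown equivalent for each [n]. With a basis [C] both
    say [n = size C]; without one neither ever holds, and both ranks are [None]. *)
Lemma orthoset_rank_ocomplK :
  orthoset_rank (ocompl (ocompl A)) = proj_rank (proj_span A).
Proof.
rewrite /orthoset_rank /proj_rank; congr (xget _ (image _ _)).
apply/funext => n; apply/propext.
have [[C oC]|noC] := pselect (exists C, orthobasis C).
  apply: (iff_trans (orthobasis_orthoset_rank _ oC)).
  exact: iff_sym (orthobasis_proj_rank _ oC).
split=> [[_ Bn]|[[B [/lines_card_seq[s [_ <- _]] BA]] _]]; case: noC.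
  apply: (@maximal_orthoseq n) => C oC CA; have [moC cC] := lines_orthoseq oC.
  rewrite -card_le_II -(card_le_eql cC); apply: Bn => //.
  exact: subset_trans CA (@proj_span_sub_ocomplK _ _ _).
have [C [oC _ sC]] := gram_schmidt s.
by exists C; split; rewrite // -BA proj_span_lines sC.
Qed.

End Rank.

(** * Adjointable maps preserve the projective structure *)

Lemma adjointable_proj_hom (F1 F2 : starSfieldType)
    (H1 : hermitianType F1) (H2 : hermitianType F2)
    (f : Proj H1 -> Proj H2) : adjointable f -> proj_hom f.
Proof.
case=> g fg; split=> [a b c abc|]; last first.
  (* The image of 0 is orthogonal to itself, because 0 is orthogonal to [g (f 0)]. *)
  by apply/proj_orthxx/fg; exact: proj_orth0x.
have [u eu] := lineP (f b); have [v ev] := lineP (f c).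
have : lines (lspan [:: u; v]) (f a).
  apply: lspan_ocomplK => y oy; apply/fg.
  have gy w : w \in [:: u; v] -> orth (line w) y.
    by move=> ws; apply/orth_sym/oy; exists w.
  (* By adjointness [b] and [c] are orthogonal to [g y]. The complement of [g y] is a projective
     subspace, so it contains [a] as well. *)
  have [_ gyj] := proj_subspace_ocompl [set g y].
  apply: (gyj b c _ _ a abc (g y)) => // _ ->; apply/fg.
    by rewrite eu; apply: gy; rewrite mem_head.
  by rewrite ev; apply: gy; rewrite !inE eqxx orbT.
rewrite eu ev pjoinE => -[w [d [_ [e [_ -> ->]] ->]] <-].
by exists (d *: u + (e *: v + 0)) => //; exists d, e; rewrite addr0.
Qed.

Theorem lemma3p17 (F1 F2 : starSfieldType)
    (H1 : hermitianType F1) (H2 : hermitianType F2)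
    (f : Proj H1 -> Proj H2) (hf : adjointable f) :
  proj_hom f /\ orthoset_map_rank f = proj_hom_rank f.
Proof.
by split; [exact: adjointable_proj_hom|exact: orthoset_rank_ocomplK].
Qed.
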